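(* Let $\mathcal T$ be a set of tile designs for the tetrakis hexahedron with symmetry group the full octahedral group $O_h$ (order $48$). Suppose there are $t_{\mathrm{id}}$ tiles, of which $t_f$ are fixed under the reflection (flip) of the isosceles triangular face. Then the number of ways of tiling the faces of the tetrakis hexahedron up to full octahedral symmetry $O_h$ is $$\frac{1}{48}\left(t_{\mathrm{id}}^{24}+6t_{\mathrm{id}}^6+3t_{\mathrm{id}}^{12}+8t_{\mathrm{id}}^8+6t_{\mathrm{id}}^{12}+t_{\mathrm{id}}^{12}+6t_{\mathrm{id}}^6+3t_{\mathrm{id}}^8t_f^8+8t_{\mathrm{id}}^4+6t_{\mathrm{id}}^{12}\right)$$ $$=\frac{1}{48}\left(t_{\mathrm{id}}^{24}+16t_{\mathrm{id}}^{12}+8t_{\mathrm{id}}^8+12t_{\mathrm{id}}^6+8t_{\mathrm{id}}^4+3t_{\mathrm{id}}^8t_f^8\right).$$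
   Context: Tilings. Let $P$ be a polyhedron with set of faces $\mathcal F$ and let $\mathcal A$ be a group of isometries of $P$, acting on $\mathcal F$. A set of tile designs is a finite set $\mathcal T$ together with a group action of $\mathcal A$ on $\mathcal T\times\mathcal F$ lying over the action on $\mathcal F$ (so $A\cdot(T,F)=(T',A\cdot F)$ for some $T'\in\mathcal T$). A tiling is a map $\tau:\mathcal F\to\mathcal T$; $\mathcal A$ acts on tilings by moving graphs: $A\cdot\tau$ is the tiling with $((A\cdot\tau)(A\cdot F),A\cdot F)=A\cdot(\tau(F),F)$ for all $F$. The number of ways of tiling up to $\mathcal A$ is the number of $\mathcal A$-orbits on the set of tilings. The induced symmetry group $G$ of a face $F$ is the group of isometries of $F$ realized by elements of the stabilizer $\mathcal A_F$; for $g\in G$, $t_g$ is the number of $T\in\mathcal T$ with $g\cdot(T,F)=(T,F)$, where $g$ acts via the element of $\mathcal A_F$ inducing it. Since $\mathcal A$ acts transitively on faces, $t_g$ does not depend on the choice of $F$. In particular $t_{\mathrm{id}}=|\mathcal T|$. Polyhedron and group. Here $\mathcal A=O_h$ is the group of order $48$ of all $3\times3$ signed permutation matrices. The tetrakis hexahedron (dual of the truncated octahedron) is the convex hull of the $O_h$-orbits of $(1,0,0)$ and $\frac23(1,1,1)$ ($6+8=14$ vertices, $24$ isosceles triangular faces). The induced symmetry group of a face is $\langle f\mid f^2=e\rangle$, with $f$ the reflection of the isosceles triangle. *)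

(* Defs.v *)
From mathcomp Require Import all_boot all_order all_algebra finmap.
From mathcomp Require Import fingroup perm.
From mathcomp Require Import boolp classical_sets functions cardinality reals convex.

Set Implicit Arguments.
Unset Strict Implicit.
Unset Printing Implicit Defensive.

Import Order.TTheory GRing.Theory Num.Theory.
Local Open Scope classical_set_scope.
Local Open Scope ring_scope.

Section Polyhedra.
Variable R : realType.
Implicit Types (P : set 'cV[R]_3) (G : set 'M[R]_3).

Definition convex_hull (S : set 'cV[R]_3) : set 'cV[R]_3 :=
  smallest (@convex_set R 'cV[R]_3) S.

(* The two-dimensional faces, as point sets: intersections of P with a
   supporting plane that contain three affinely independent points. *)
Definition facets P : set (set 'cV[R]_3) :=
  [set F | exists (c : 'rV[R]_3) (b : R),
    [/\ c != 0,
        forall x, P x -> (c *m x) 0 0 <= b,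
        F = P `&` [set x | (c *m x) 0 0 = b] &
        exists x y z,
          [/\ F x, F y, F z & \rank (row_mx (y - x) (z - x)) = 2%N]]].

(* A group of linear isometries is given as a set G of matrices, acting on
   column vectors from the left; only the values of [act] on G matter. *)
Record tile_designs P G := TileDesigns {
  tile : finType;
  act : 'M[R]_3 -> tile * facets P -> tile * facets P;
  act1 : forall p, act 1%:M p = p;
  actM : forall A B p, G A -> G B -> act (A *m B) p = act A (act B p);
  act_over : forall A T (F : facets P), G A ->
    val (act A (T, F)).2 = mulmx A @` val F
}.
Arguments act {P G} t A p.

Section Tilings.
Variables (P : set 'cV[R]_3) (G : set 'M[R]_3) (TD : tile_designs P G).

Definition tiling := facets P -> tile TD.

Definition tiling_graph (tau : tiling) : set (tile TD * facets P) :=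
  [set (tau F, F) | F in [set: facets P]].

Definition moves_to (A : 'M[R]_3) (tau tau' : tiling) : Prop :=
  act TD A @` tiling_graph tau = tiling_graph tau'.

Definition tiling_orbit (tau : tiling) : set tiling :=
  [set tau' | exists2 A, G A & moves_to A tau tau'].

Definition tiling_orbits : set (set tiling) := range tiling_orbit.

(* [fset_set] sends infinite sets to the empty set, so this is meaningful only
   together with [finite_set tiling_orbits]. *)
Definition number_of_tilings : nat := #|` fset_set tiling_orbits|.

Definition face_stabilizer (F : facets P) : set 'M[R]_3 :=
  [set A | G A /\ mulmx A @` val F = val F].

Definition induces (F : facets P) (A : 'M[R]_3) (g : val F -> val F) : Prop :=
  face_stabilizer F A /\ forall x : val F, val (g x) = A *m val x.

Definition induced_symmetry_group (F : facets P) : set (val F -> val F) :=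
  [set g | exists A, induces A g].

(* The number t_g. An isometry A inducing g is unique when F spans the space,
   as is the case for a facet of a polyhedron with the origin in its interior. *)
Definition fixed_tiles (F : facets P) (g : val F -> val F) : nat :=
  #|[pred T : tile TD |
      `[< exists2 A, induces A g & act TD A (T, F) = (T, F) >]]|.

End Tilings.

(* The reflection of an isosceles triangle with apex a and base bc; lengths are
   Euclidean, the norm on matrices being the sup norm. *)
Definition isosceles_reflection (F : set 'cV[R]_3) (g : F -> F) : Prop :=
  exists a b c : F,
    [/\ F = convex_hull [set val a; val b; val c],
        b <> c,
        (val a - val b)^T *m (val a - val b)
          = (val a - val c)^T *m (val a - val c) &
        [/\ g a = a, g b = c & g c = b]].

(* The full octahedral group O_h: 3 x 3 signed permutation matrices. *)
Definition full_octahedral : set 'M[R]_3 :=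
  [set A | exists (d : 'rV[R]_3) (s : 'S_3),
    (forall i, d 0 i = 1 \/ d 0 i = -1) /\ A = diag_mx d *m perm_mx s].

Definition tetrakis_hexahedron : set 'cV[R]_3 :=
  convex_hull
    ([set A *m delta_mx 0 0 | A in full_octahedral] `|`
     [set A *m ((2%:R / 3%:R) *: const_mx 1) | A in full_octahedral]).

End Polyhedra.

Arguments full_octahedral R : clear implicits.
Arguments tetrakis_hexahedron R : clear implicits.
Arguments induced_symmetry_group {R P} G F.
Arguments tiling_orbits {R P G} TD.
Arguments number_of_tilings {R P G} TD.
Arguments fixed_tiles {R P G} TD {F} g.

(* Main.v *)
From HB Require Import structures.
Require Import Defs.
From mathcomp Require Import all_boot all_order all_algebra finmap.
From mathcomp Require Import fingroup perm action cyclic burnside_app.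
From mathcomp Require Import boolp classical_sets functions cardinality reals.
From mathcomp Require Import convex interval_inference.
From mathcomp Require Import zify ring lra.

Set Implicit Arguments.
Unset Strict Implicit.
Unset Printing Implicit Defensive.

Import Order.TTheory GRing.Theory Num.Theory.

(** A tiling is a section of the projection [tile * face -> face], and the
    isometry group acts on both sides of this projection.  By the
    Cauchy-Frobenius (Burnside) formula the number of orbits of tilings is the
    average, over the 48 isometries, of the number of tilings that an isometry
    fixes.

    A section fixed by a group [H] is determined by its values on one face of
    each [H]-orbit, and the value at such a face [x] may be any tile fixed by the
    stabilizer of [x] in [H]; this is [card_fixed_sections].  For an isometry [g]
    all of whose nontrivial powers move every face, the cyclic group of [g] has
    [24 / #[g]] orbits on the faces and there is no constraint on the tiles, so
    [g] fixes [t ^ (24 / #[g])] tilings.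

    The stabilizer of a face has order two: its nontrivial element is one of the
    three reflections [x_i -> - x_i].  No other element has such a reflection among
    its powers, so the other isometries are of the kind above.  Each of the three
    is conjugate to the others and fixes 8 of the 24 faces, on which the tile has
    to be invariant under the flip of the face, while the other 16 faces form 8
    pairs; this gives [t ^ 8 * n ^ 8] fixed tilings.  Sorting the other 45
    elements by order (1, 16, 8, 12 and 8 elements of order 1, 2, 3, 4 and 6) gives
    the formula; the sorting is a finite computation in the group of signed
    permutations ([octa_order_distribution]).

    What remains is geometry: the group permutes the facets transitively and the
    stabilizer of one facet is as stated.  The 48 images of the triangular cone
    x >= y >= z >= 0 cover the space ([exists_sorting_octa]), so every point is a
    nonnegative combination of the three vertices of one of the 24 expected
    triangles.  A supporting plane that contains three independent points of the
    polyhedron contains their centroid, hence meets the plane of one of these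
    triangles at the centroid, hence at all three points, and the two planes
    coincide ([facet_classification]). *)

(** * Sections fixed by a group *)
Section FixedSections.
Local Open Scope group_scope.

Variables (gT : finGroupType) (X T : finType).
Variables (to : {action gT &-> X}) (toE : {action gT &-> T * X}).
Hypothesis toE_over : forall p a, (toE p a).2 = to p.2 a.

Definition section_act (tau : {ffun X -> T}) (a : gT) : {ffun X -> T} :=
  [ffun x => (toE (tau (to x a^-1), to x a^-1) a).1].

(** The action on sections moves graphs: this is the relation that defines the
    action on tilings. *)
Lemma section_act_graph (tau : {ffun X -> T}) a x :
  toE (tau x, x) a = (section_act tau a (to x a), to x a).
Proof. by rewrite ffunE actK (surjective_pairing (toE _ a)) toE_over. Qed.

Lemma section_actP (tau tau' : {ffun X -> T}) a :
  (forall x, toE (tau x, x) a = (tau' (to x a), to x a)) <->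
  section_act tau a = tau'.
Proof.
split=> [tauE | <- x]; last exact: section_act_graph.
by apply/ffunP=> x; rewrite ffunE tauE /= actKV.
Qed.

Lemma section_act1 : section_act^~ 1 =1 id.
Proof. by move=> tau; apply/section_actP => x; rewrite !act1. Qed.

Lemma section_actM tau : act_morph section_act tau.
Proof.
move=> a b; apply/section_actP => x.
by rewrite !actM !section_act_graph.
Qed.

Definition section_action := TotalAction section_act1 section_actM.

(** The values that an [H]-fixed section can take at [x]. *)
Definition fixed_fibre (H : {set gT}) (x : X) : {set T} :=
  [set t | [forall b in 'C_H[x | to], toE (t, x) b == (t, x)]].

Lemma fixed_fibreP (H : {set gT}) x t :
  reflect {in H, forall b, to x b = x -> toE (t, x) b = (t, x)}
          (t \in fixed_fibre H x).
Proof.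
rewrite inE; apply: (iffP forall_inP) => fixt b.
  by move=> Hb xb; apply/eqP/fixt; rewrite inE Hb; apply/astab1P.
by case/finset.setIP=> Hb /astab1P xb; rewrite fixt.
Qed.

(** Restriction to a set of orbit representatives is a bijection from the fixed
    sections to the families of admissible values: a value at a representative is
    carried along its orbit by the action, and the stabilizer condition says
    precisely that the result does not depend on the element used. *)
Lemma card_fixed_sections (H : {group gT}) :
  #|'Fix_section_action(H)| =
    (\prod_(x in orbit_transversal to H [set: X]) #|fixed_fibre H x|)%N.
Proof.
have actsH : [acts H, on [set: X] | to] by apply/actsP => a _ x; rewrite !inE.
set Tr := orbit_transversal _ _ _.
have [_ _ Tr_uniq Tr_ex] := orbit_transversalP actsH.
pose S := {x | x \in Tr}.
have rep_ex y : exists p : S * gT, (p.2 \in H) && (to y p.2 == val p.1).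
  have [a Ha Tra] := Tr_ex y (finset.in_setT y).
  by exists (exist (fun x => x \in Tr) _ Tra, a); rewrite /= Ha eqxx.
(* Every [y] is moved by [mov y] to its representative [rep y]. *)
pose rep y := (xchoose (rep_ex y)).1; pose mov y := (xchoose (rep_ex y)).2.
have movH y : mov y \in H by have /andP[] := xchooseP (rep_ex y).
have movE y : to y (mov y) = val (rep y).
  by have /andP[_ /eqP] := xchooseP (rep_ex y).
have rep_eq y z b : b \in H -> to y b = z -> rep y = rep z.
  move=> Hb yb; apply/val_inj/eqP.
  rewrite -(Tr_uniq _ _ (valP _) (valP _)); apply/orbitP.
  exists ((mov y)^-1 * b * mov z); first by rewrite !groupM ?groupV.
  by rewrite !actM -movE actK yb movE.
have repK (s : S) : rep (val s) = s.
  apply/val_inj/eqP; rewrite eq_sym -(Tr_uniq _ _ (valP _) (valP _)).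
  by apply/orbitP; exists (mov (val s)); rewrite ?movE.
pose restr (tau : {ffun X -> T}) : {ffun S -> T} := [ffun s => tau (val s)].
pose F (s : S) := fixed_fibre H (val s).
have fixP (tau : {ffun X -> T}) : reflect
    {in H, forall b x, toE (tau x, x) b = (tau (to x b), to x b)}
    (tau \in 'Fix_section_action(H)).
  apply: (iffP afixP) => fixtau b Hb; last exact/section_actP/fixtau.
  exact/section_actP/fixtau.
have restr_inj : {in 'Fix_section_action(H) &, injective restr}.
  move=> tau tau' /fixP fixtau /fixP fixtau' /ffunP eq_restr; apply/ffunP => y.
  have /= := eq_restr (rep y); rewrite !ffunE -movE => eqy.
  have := fixtau' _ (movH y) y; rewrite -eqy -fixtau //.
  by move/act_inj=> [].
rewrite -(card_in_imset restr_inj).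
transitivity #|family F|; last first.
  by rewrite card_family foldrE big_image /= [RHS]big_sub.
apply: eq_card => phi.
apply/imsetP/familyP => [[tau /fixP fixtau ->] s | famphi].
  by rewrite ffunE; apply/fixed_fibreP => b Hb sb; rewrite fixtau ?sb.
(* The section extending [phi]: bring back to [y] the value at [rep y]. *)
pose pull y := toE (phi (rep y), val (rep y)) (mov y)^-1.
have pull2 y : (pull y).2 = y by rewrite toE_over /= -movE actK.
exists [ffun y => (pull y).1]; last first.
  apply/ffunP => s; rewrite !ffunE /pull repK.
  have /fixed_fibreP -> // := famphi s; first by rewrite groupV.
  by rewrite -{1}[s]repK -movE actK.
apply/fixP => b Hb y.
have -> : ([ffun y => (pull y).1] y, y) = pull y.
  by rewrite ffunE [RHS]surjective_pairing pull2.
have -> : ([ffun y => (pull y).1] (to y b), to y b) = pull (to y b).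
  by rewrite ffunE [RHS]surjective_pairing pull2.
apply: (canRL (actK toE _)); rewrite /pull -!actM.
rewrite -(rep_eq _ _ _ Hb erefl).
have /fixed_fibreP := famphi (rep y); apply.
  by rewrite !groupM ?groupV.
by rewrite !actM -movE actK movE -(rep_eq _ _ _ Hb erefl).
Qed.

Let acts_setT (H : {group gT}) : [acts H, on [set: X] | to].
Proof. by apply/actsP => a _ x; rewrite !inE. Qed.

Lemma card_orbit_transversal (H : {group gT}) :
  #|orbit_transversal to H [set: X]| = #|orbit to H @: [set: X]|.
Proof.
have [trXP _ _ _] := orbit_transversalP (acts_setT H).
by rewrite (card_transversal trXP).
Qed.

Lemma fixed_fibreT (H : {set gT}) x :
  'C_H[x | to] = 1 -> fixed_fibre H x = [set: T].
Proof.
move=> stab1; apply/setP=> t; rewrite !inE stab1.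
by apply/forall_inP => b /set1P ->; rewrite act1.
Qed.

(** All orbits of [<[a]>] have [#[a]] elements, and no value is excluded. *)
Lemma card_fixed_sections_free a :
  (forall x, 'C_<[a]>[x | to] = 1) ->
  #|'Fix_section_action[a]| = (#|T| ^ (#|X| %/ #[a]))%N.
Proof.
move=> free; rewrite -afix_cycle card_fixed_sections.
rewrite (eq_bigr (fun=> #|T|)) => [|x _]; last by rewrite fixed_fibreT ?cardsT.
rewrite prod_nat_const card_orbit_transversal; congr (_ ^ _)%N.
have orbE : {in orbit to <[a]> @: [set: X], forall A : {set X}, #|A| = #[a]}.
  by move=> _ /imsetP[x _ ->]; rewrite card_orbit free indexg1.
rewrite -cardsT (card_uniform_partition orbE (orbit_partition (acts_setT _))).
by rewrite mulnK ?order_gt0.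
Qed.

(** The orbits are the fixed points of [a], where the value must be [a]-invariant,
    and pairs, where it is free. *)
Lemma card_fixed_sections_involution a n :
    #[a] = 2 ->
    (forall x, to x a = x -> #|[set t | toE (t, x) a == (t, x)]| = n) ->
  #|'Fix_section_action[a]| =
    (#|T| ^ ((#|X| - #|'Fix_to[a]|)./2) * n ^ #|'Fix_to[a]|)%N.
Proof.
move=> oa fixn; rewrite -afix_cycle card_fixed_sections.
set Tr := orbit_transversal _ _ _.
have cyc b : (b \in <[a]>) = (b == 1) || (b == a).
  by rewrite cycle2g // !inE.
have [_ _ _ Tr_ex] := orbit_transversalP (acts_setT <[a]>).
have sFixTr : 'Fix_to[a] \subset Tr.
  apply/fintype.subsetP=> x /afix1P xa; have [b] := Tr_ex x (finset.in_setT x).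
  by rewrite cyc => /orP[] /eqP ->; rewrite ?act1 ?xa.
(* The number of orbits of a group of order two, by Cauchy-Frobenius. *)
have cardTr : (#|Tr| * 2 = #|X| + #|'Fix_to[a]|)%N.
  rewrite card_orbit_transversal -{1}oa /order -Frobenius_Cauchy ?acts_setT //.
  rewrite (big_setD1 1) ?group1 //= (_ : <[a]> :\ 1 = [set a]); last first.
    apply/setP=> b; rewrite !inE cyc; case: eqP => //= ->.
    by apply/esym/eqP => a1; move: oa; rewrite -a1 order1.
  rewrite big_set1 !finset.setTI; congr (_ + _)%N; rewrite -cardsT.
  apply: eq_card => x.
  by rewrite finset.in_setT; apply/afix1P; rewrite act1.
rewrite (big_setID 'Fix_to[a]) /= (finset.setIidPr sFixTr) mulnC.
congr (_ * _)%N.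
  rewrite (eq_bigr (fun=> #|T|)) => [|x /finset.setDP[_ nfix]].
    rewrite prod_nat_const cardsD (finset.setIidPr sFixTr); congr (_ ^ _)%N.
    rewrite -(doubleK (#|Tr| - _)%N) -muln2 mulnBl cardTr; congr (_./2).
    by rewrite muln2 -addnn subnDr.
  rewrite fixed_fibreT ?cardsT //; apply/trivgP/fintype.subsetP => b.
  case/finset.setIP; rewrite cyc => /orP[/eqP-> | /eqP-> /astab1P xa].
    by rewrite inE.
  by case/afix1P: nfix.
rewrite (eq_bigr (fun=> n)) ?prod_nat_const // => x /afix1P xa.
rewrite -(fixn x xa); apply: eq_card => t; rewrite [RHS]inE.
apply/fixed_fibreP/eqP => [-> // | fixt b]; first exact: cycle_id.
by rewrite cyc => /orP[] /eqP -> // _; rewrite act1.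
Qed.

End FixedSections.

(** * The group of signed permutations of three axes *)
Section SignedPermutations.
Local Open Scope ring_scope.

(** Signs of the images of the three basis vectors, and a permutation of the axes.
    Every permutation of Z/3 is affine, [i -> r + i] or [i -> r - i], and is stored
    as the pair of [r] and of a boolean; with this encoding the group can be
    enumerated and its elements multiplied by computation. *)
Definition octa : Type := ((bool * bool * bool) * ('I_3 * bool))%type.
HB.instance Definition _ := Finite.on octa.

Implicit Types g h : octa.

Definition axis_map g (i : 'I_3) : 'I_3 :=
  if g.2.2 then g.2.1 - i else g.2.1 + i.

Definition axis_flip g (i : 'I_3) : bool :=
  if val i is k.+1 then if k is 0%N then g.1.1.2 else g.1.2 else g.1.1.1.

Definition mk_octa (s : 'I_3 -> bool) (r : 'I_3) (m : bool) : octa :=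
  ((s 0, s 1, s 2%:R), (r, m)).

Lemma axis_flip_mk s r m : axis_flip (mk_octa s r m) =1 s.
Proof. by case=> [[|[|[|]]]] //= p; congr s; apply/val_inj. Qed.

Lemma octa_ext g h :
  axis_flip g =1 axis_flip h -> axis_map g =1 axis_map h -> g = h.
Proof.
case: g h => [[[a b] c] [r m]] [[[a' b'] c'] [r' m']] eq_flip eq_map.
have -> : a = a' := eq_flip 0; have -> : b = b' := eq_flip 1.
have -> : c = c' := eq_flip 2%:R.
have := eq_map 1; have := eq_map 0; rewrite /axis_map /=.
rewrite !subr0 !addr0 !if_same => -> eq1; suff -> : m = m' by [].
by case: m m' eq1 {eq_map eq_flip} => [] [] //= /addrI.
Qed.

(** The reflection in the plane z = 0. *)
Definition face_reflection : octa := ((false, false, true), (0, false)).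

(** The product is in the order of right actions: first [g], then [h]. *)
Definition octa_mul g h : octa :=
  mk_octa (fun i => axis_flip g i (+) axis_flip h (axis_map g i))
          (axis_map h (axis_map g 0)) (g.2.2 (+) h.2.2).

Definition octa_one : octa := mk_octa (fun=> false) 0 false.

Definition octa_inv g : octa :=
  let r := if g.2.2 then g.2.1 else - g.2.1 in
  mk_octa (fun i => axis_flip g (if g.2.2 then r - i else r + i)) r g.2.2.

Lemma axis_map_mul g h : axis_map (octa_mul g h) =1 axis_map h \o axis_map g.
Proof.
move=> i; rewrite /= /axis_map /= /axis_map.
by case: g.2.2; case: h.2.2;
  rewrite /= ?subr0 ?addr0 ?opprB ?opprD ?opprK ?addrA // addrAC.
Qed.

Lemma axis_flip_mul g h i :
  axis_flip (octa_mul g h) i = axis_flip g i (+) axis_flip h (axis_map g i).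
Proof. exact: axis_flip_mk. Qed.

Lemma octa_mulA : associative octa_mul.
Proof.
move=> g h k; apply: octa_ext => i.
  by rewrite !(axis_flip_mul, axis_map_mul) /= addbA.
by rewrite !axis_map_mul /= !axis_map_mul.
Qed.

Lemma octa_mul1 : left_id octa_one octa_mul.
Proof.
have map1 i : axis_map octa_one i = i by rewrite /axis_map /= add0r.
by move=> g; apply: octa_ext => i;
  rewrite ?axis_map_mul ?axis_flip_mul /= map1 ?axis_flip_mk.
Qed.

Lemma octa_mulV : left_inverse octa_one octa_inv octa_mul.
Proof.
have mapV g i : axis_map g (axis_map (octa_inv g) i) = i.
  by rewrite /axis_map /=; case: g.2.2; rewrite ?subKr ?addKr ?addNKr.
move=> g; apply: octa_ext => i.
  by rewrite axis_flip_mul !axis_flip_mk addbb.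
by rewrite axis_map_mul /= mapV /axis_map /= add0r.
Qed.

HB.instance Definition _ :=
  Finite_isGroup.Build octa octa_mulA octa_mul1 octa_mulV.

Lemma axis_mapM g h i : axis_map (g * h)%g i = axis_map h (axis_map g i).
Proof. exact: axis_map_mul. Qed.

Lemma axis_map1 i : axis_map 1%g i = i.
Proof. by rewrite /axis_map /= add0r. Qed.

Lemma axis_mapK g : cancel (axis_map g) (axis_map g^-1%g).
Proof. by move=> i; rewrite -axis_mapM mulgV axis_map1. Qed.

Lemma axis_mapVK g : cancel (axis_map g^-1%g) (axis_map g).
Proof. by move=> i; rewrite -axis_mapM mulVg axis_map1. Qed.

Lemma axis_map_inj g : injective (axis_map g).
Proof. exact: can_inj (axis_mapK g). Qed.

Lemma axis_map_reflection j : axis_map face_reflection j = j.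
Proof. by rewrite /axis_map /= add0r. Qed.

Lemma ord3_cases (i : 'I_3) : [\/ i = 0, i = 1 | i = 2%:R].
Proof.
by case: i => [[|[|[|]]]] // p;
  [apply: Or31 | apply: Or32 | apply: Or33]; apply/val_inj.
Qed.

(** The encoding of permutations by affine maps loses nothing. *)
Lemma ord3_injective_affine (u : 'I_3 -> 'I_3) : injective u ->
  exists r m, forall i, u i = if m then r - i else r + i.
Proof.
move=> u_inj; exists (u 0), (u 1 != u 0 + 1).
have : uniq [:: u 0; u 1; u 2%:R] by rewrite /= !inE !(inj_eq u_inj).
suff all_maps : forall a b c : 'I_3, uniq [:: a; b; c] ->
    let aff i := if b != a + 1 then a - i else a + i in
    [&& aff 0 == a, aff 1 == b & aff 2%:R == c].
  move=> /all_maps /and3P[/eqP e0 /eqP e1 /eqP e2] i.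
  have [->|->|->] : [\/ i = 0, i = 1 | i = 2%:R] by exact: ord3_cases.
  - by rewrite -[LHS]e0.
  - by rewrite -[LHS]e1.
  - by rewrite -[LHS]e2.
by move=> [[|[|[|]]] // p] [[|[|[|]]] // q] [[|[|[|]]] // s]; vm_compute.
Qed.

Definition octas : seq octa :=
  let bs := [:: false; true] in
  [seq (s, p) | s <- [seq (ab, c) | ab <- [seq (a, b) | a <- bs, b <- bs],
                                    c <- bs],
                p <- [seq (r, m) | r <- [:: 0; 1; 2%:R], m <- bs]].

Lemma mem_octas g : g \in octas.
Proof.
have mem_bs (b : bool) : b \in [:: false; true] by case: b.
have mem_I (r : 'I_3) : r \in [:: 0; 1; 2%:R] by case: r => [[|[|[|]]]].
by case: g => [[[a b] c] [r m]]; rewrite !allpairs_f.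
Qed.

Lemma octas_uniq : uniq octas. Proof. by vm_compute. Qed.

(** The three reflections that change the sign of one coordinate. *)
Definition coordinate_reflection g : bool :=
  (g.2 == (0, false)) && (g.1.1.1 + g.1.1.2 + g.1.2 == 1)%N.

(** A computable version of the order: no element has order above 6. *)
Definition octa_order g : nat :=
  (find (fun k => (g ^+ k.+1)%g == 1%g) (iota 0 6)).+1.

Lemma octa_order_has g : has (fun k => (g ^+ k.+1)%g == 1%g) (iota 0 6).
Proof.
suff /allP :
    all (fun g => has (fun k => (g ^+ k.+1)%g == 1%g) (iota 0 6)) octas.
  by apply; apply: mem_octas.
by vm_compute.
Qed.

Lemma octa_orderE g : #[g]%g = octa_order g.
Proof.
have := octa_order_has g; set p := fun k => _ == _ => hasp.
have lt6 : (find p (iota 0 6) < 6)%N by rewrite has_find in hasp.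
have := nth_find 0 hasp; rewrite nth_iota // add0n => /eqP pfind.
rewrite /octa_order -/p.
have dvd_find : (#[g]%g %| (find p (iota 0 6)).+1)%N.
  by rewrite order_dvdn pfind.
apply/eqP; rewrite eqn_leq (dvdn_leq _ dvd_find) //= leqNgt.
apply/negP => lt_order.
have lt_find : (#[g]%g.-1 < find p (iota 0 6))%N.
  by rewrite -ltnS prednK ?order_gt0.
have := before_find 0 lt_find; rewrite nth_iota; last exact: ltn_trans lt6.
by rewrite add0n /p prednK ?order_gt0 // expg_order eqxx.
Qed.

(** Apart from the three reflections, an element contributes to the count through
    its order alone. *)
Lemma octa_order_distribution :
  perm_eq [seq (coordinate_reflection g, octa_order g) | g <- octas]
    ((false, 1%N) :: nseq 16 (false, 2%N) ++ nseq 8 (false, 3%N) ++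
     nseq 12 (false, 4%N) ++ nseq 8 (false, 6%N) ++ nseq 3 (true, 2%N)).
Proof. by vm_compute. Qed.

(** No other element has a coordinate reflection among its powers: the cube of an
    element of order 6 is the inversion, the square of one of order 4 a rotation. *)
Lemma coordinate_reflection_expg g k :
  coordinate_reflection (g ^+ k)%g -> coordinate_reflection g.
Proof.
suff : all (fun g => all (fun k => coordinate_reflection (g ^+ k)%g ==>
                           coordinate_reflection g) (iota 0 6)) octas.
  move=> /allP/(_ g (mem_octas g))/allP/(_ (k %% #[g]%g)%N).
  rewrite expg_mod_order mem_iota /= add0n => mod_case; apply/implyP/mod_case.
  apply: leq_trans (ltn_pmod _ (order_gt0 g)) _.
  by rewrite octa_orderE; have := octa_order_has g; rewrite has_find.
by vm_compute.
Qed.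

Lemma coordinate_reflectionP g :
  reflect (exists h, g = face_reflection ^ h)%g (coordinate_reflection g).
Proof.
suff /allP/(_ g (mem_octas g))/eqP -> :
    all (fun g => coordinate_reflection g ==
           has (fun h => g == face_reflection ^ h)%g octas) octas.
  apply: (iffP hasP) => [[h _ /eqP]|[h ->]]; exists h => //.
  exact: mem_octas.
by vm_compute.
Qed.

End SignedPermutations.

(** * Counting sections over the faces *)
Section FaceSections.
Local Open Scope group_scope.
Variables (X T : finType).
Variables (to : {action octa &-> X}) (toE : {action octa &-> T * X}).
Hypothesis toE_over : forall p a, (toE p a).2 = to p.2 a.
Variable x0 : X.
Hypothesis trans : forall x, exists a, x = to x0 a.
Hypothesis stab0 : 'C[x0 | to] = [set 1; face_reflection].

(** Stabilizers of different faces are conjugate, so each is of order two. *)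
Lemma face_stabilizer_conj b a :
  to (to x0 b) a = to x0 b -> a != 1 -> a = face_reflection ^ b.
Proof.
move=> xa a1; have : a ^ b^-1 \in 'C[x0 | to].
  by apply/astab1P; rewrite conjgE invgK !actM xa actK.
rewrite stab0 => /set2P[a1' | <-]; last by rewrite conjgKV.
by move: a1; rewrite -(conjgKV b a) a1' conj1g eqxx.
Qed.

Lemma face_stabilizerP x a : to x a = x -> a != 1 ->
  exists2 b, x = to x0 b & a = face_reflection ^ b.
Proof.
by have [b ->] := trans x => xa a1; exists b => //; apply: face_stabilizer_conj.
Qed.

Lemma face_stabilizer_unique x a b :
  to x a = x -> to x b = x -> a != 1 -> b != 1 -> a = b.
Proof.
have [c ->] := trans x => /face_stabilizer_conj xa /face_stabilizer_conj xb.
by move=> /xa-> /xb->.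
Qed.

Lemma card_faces : #|X| = 24%N.
Proof.
have := card_orbit_stab to [set: octa] x0.
rewrite finset.setTI stab0 cards2 finset.cardsT.
have -> : #|{: octa}| = 48 by rewrite !card_prod card_ord !card_bool.
have -> : orbit to [set: octa] x0 = [set: X].
  apply/setP=> x; rewrite inE; apply/orbitP.
  by have [a ->] := trans x; exists a.
have -> : (1 != face_reflection :> octa) by vm_compute.
by rewrite finset.cardsT => /eqP; rewrite (@eqn_pmul2r 2 _ 24) // => /eqP.
Qed.

Lemma sum_over_octas (phi : bool * nat -> nat) (F : octa -> nat) :
    (forall g, F g = phi (coordinate_reflection g, #[g])) ->
  (\sum_(g <- octas) F g =
     phi (false, 1) + 16 * phi (false, 2) + 8 * phi (false, 3) +
     12 * phi (false, 4) + 8 * phi (false, 6) + 3 * phi (true, 2))%N.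
Proof.
move=> FE; under eq_bigr do rewrite FE octa_orderE.
rewrite -(big_map _ predT phi) (perm_big _ octa_order_distribution) /=.
by rewrite !(big_cons, big_cat, big_nil) /=; lia.
Qed.

Lemma card_afixJ (a b : octa) : #|'Fix_to[a ^ b]| = #|'Fix_to[a]|.
Proof.
rewrite -[RHS](card_imset _ (act_inj to b)); apply: eq_card => x.
apply/afix1P/imsetP => [xab | [y /afix1P ya ->]].
  exists (to x b^-1); last by rewrite actKV.
  by apply/afix1P; rewrite -actM -[in RHS]xab conjgE -actM !mulgA mulgK.
by rewrite conjgE !actM actK ya.
Qed.

Lemma nonreflection_moves_faces (a : octa) x :
  a != 1 -> ~~ coordinate_reflection a -> to x a != x.
Proof.
move=> a1; apply: contraNneq => /face_stabilizerP[] // b _ ->.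
by apply/coordinate_reflectionP; exists b.
Qed.

Lemma reflection_order (a : octa) : coordinate_reflection a -> #[a] = 2.
Proof.
case/coordinate_reflectionP => b ->; rewrite orderJ octa_orderE.
by vm_compute.
Qed.

(** Cauchy-Frobenius for the single orbit of faces: [48 = 24 + 3 * k], where [k] is
    the number of faces fixed by each of the three conjugate reflections and the
    other nontrivial elements fix none. *)
Lemma card_faces_fixed_reflection a :
  coordinate_reflection a -> #|'Fix_to[a]| = 8%N.
Proof.
case/coordinate_reflectionP => b ->; rewrite card_afixJ.
set k := #|_|.
pose phi (p : bool * nat) := if p.1 then k else if p.2 == 1%N then 24 else 0%N.
have FE g : #|'Fix_to[g]| = phi (coordinate_reflection g, #[g]).
  rewrite /phi /=; case: ifP => [/coordinate_reflectionP[c ->] | /negbT grefl].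
    exact: card_afixJ.
  rewrite order_eq1; have [-> | g1] := eqVneq.
    by rewrite -card_faces; apply: eq_card => x; apply/afix1P; rewrite act1.
  apply: eq_card0 => x; apply/afix1P/eqP; exact: nonreflection_moves_faces.
have := burnside_formula octas [group of [set: octa]] octas_uniq _ X to.
rewrite (sum_over_octas FE) /phi /=.
have -> : orbit to [set: octa] @: [set: X] = [set [set: X]].
  apply/setP => A; rewrite !inE; apply/imsetP/eqP => [[x _ ->] | ->].
    apply/setP=> y; rewrite inE; apply/orbitP; have [c ->] := trans x.
    have [d ->] := trans y; exists (c^-1 * d) => //.
    by rewrite actM actK.
  exists x0 => //; apply/esym/setP => y; rewrite inE.
  by apply/orbitP; have [d ->] := trans y; exists d.
rewrite cards1 => sum_eq.
have := sum_eq (fun g => etrans (mem_octas g) (esym (finset.in_setT g))).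
by lia.
Qed.

(** The number of flip-invariant tiles is the same at each face, because an element
    that moves one face to another conjugates the flips. *)
Lemma card_fixed_tiles_transport x a : to x a = x -> a != 1 ->
  #|[set t | toE (t, x) a == (t, x)]| =
  #|[set t | toE (t, x0) face_reflection == (t, x0)]|.
Proof.
move=> xa a1; have [b xE aE] := face_stabilizerP xa a1.
have tE t c y : toE (t, y) c = ((toE (t, y) c).1, to y c).
  by rewrite [LHS]surjective_pairing toE_over.
pose f t := (toE (t, x0) b).1.
have fE t : toE (t, x0) b = (f t, x) by rewrite tE -xE.
have finj : injective f.
  move=> t t' ftt'; suff /act_inj[] : toE (t, x0) b = toE (t', x0) b by [].
  by rewrite !fE ftt'.
rewrite -[RHS](card_imset _ finj); apply: eq_card => t; rewrite inE.
apply/eqP/imsetP => [ta | [s]].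
  have back : ((toE (t, x) b^-1).1, x0) = toE (t, x) b^-1.
    by rewrite [RHS]tE xE actK.
  exists (toE (t, x) b^-1).1; last by rewrite /f back actKV.
  rewrite inE back.
  by rewrite -actM -[in X in _ == X]ta aE conjgE -actM !mulgA mulgK.
rewrite inE => /eqP sfix ->; rewrite -fE aE conjgE !actM actK.
by rewrite sfix.
Qed.

Theorem card_section_orbits :
  let t := #|T| in
  let n := #|[set t | toE (t, x0) face_reflection == (t, x0)]| in
  (#|orbit (section_action toE_over) [set: octa] @: [set: {ffun X -> T}]|
     * 48 =
   t ^ 24 + 16 * t ^ 12 + 8 * t ^ 8 + 12 * t ^ 6 + 8 * t ^ 4
   + 3 * t ^ 8 * n ^ 8)%N.
Proof.
move=> t n.
pose phi (p : bool * nat) := (if p.1 then t ^ 8 * n ^ 8 else t ^ (24 %/ p.2))%N.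
pose sact := section_action toE_over.
have FE g : #|'Fix_sact[g]| = phi (coordinate_reflection g, #[g]).
  rewrite /phi /=; case: ifP => [grefl | /negbT grefl].
    rewrite (@card_fixed_sections_involution _ _ _ to toE toE_over g n).
    - by rewrite card_faces card_faces_fixed_reflection.
    - exact: reflection_order.
    - move=> x xg; apply: card_fixed_tiles_transport => //.
      by apply: contraTneq grefl => ->; vm_compute.
  rewrite card_fixed_sections_free -/t ?card_faces // => x.
  apply/trivgP/fintype.subsetP => b /finset.setIP[/cycleP[i ->] /astab1P xb].
  rewrite inE.
  apply: contra_eqT xb => gi1; apply: nonreflection_moves_faces => //.
  by apply: contra grefl; apply: coordinate_reflection_expg.
have := burnside_formula octas [group of [set: octa]] octas_uniq _ _ sact.
rewrite (sum_over_octas FE) => ->; first by rewrite /phi /= mulnA.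
by move=> g; rewrite mem_octas inE.
Qed.

End FaceSections.

Local Open Scope classical_set_scope.
Local Open Scope ring_scope.

(** * The facets of the tetrakis hexahedron *)
Section Geometry.
Variable R : realType.
Local Notation Oh := (full_octahedral R).
Local Notation P := (tetrakis_hexahedron R).
Implicit Types (g h : octa) (b : R) (p x y z : 'cV[R]_3) (c : 'rV[R]_3).

Definition octa_mx g : 'M[R]_3 :=
  \matrix_(i, j) ((-1) ^+ axis_flip g j * (i == axis_map g j)%:R).

Lemma mul_row_octa c g j :
  (c *m octa_mx g) 0 j = (-1) ^+ axis_flip g j * c 0 (axis_map g j).
Proof.
rewrite mxE (bigD1 (axis_map g j)) //= big1 ?addr0 => [|i /negPf ij].
  by rewrite mxE eqxx mulr1 mulrC.
by rewrite mxE ij !mulr0.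
Qed.

(** Matrices act on columns from the left, whence the reversal. *)
Lemma octa_mxM g h : octa_mx (g * h)%g = octa_mx h *m octa_mx g.
Proof.
apply/matrixP => i j; rewrite !mxE (bigD1 (axis_map g j)) //=.
rewrite big1 => [|k /negPf kj].
  rewrite !mxE eqxx mulr1 addr0 axis_flip_mul axis_map_mul /= signr_addb.
  by ring.
by rewrite !mxE kj !mulr0.
Qed.

Lemma octa_mx1 : octa_mx 1%g = 1%:M.
Proof.
apply/matrixP => i j; rewrite !mxE axis_flip_mk /= mul1r.
by rewrite /axis_map /= add0r.
Qed.

Lemma octa_mxK g x : octa_mx g^-1%g *m (octa_mx g *m x) = x.
Proof. by rewrite mulmxA -octa_mxM mulgV octa_mx1 mul1mx. Qed.

Lemma octa_mxVK g x : octa_mx g *m (octa_mx g^-1%g *m x) = x.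
Proof. by rewrite mulmxA -octa_mxM mulVg octa_mx1 mul1mx. Qed.

Lemma octa_mx_act g x j :
  (octa_mx g *m x) (axis_map g j) 0 = (-1) ^+ axis_flip g j * x j 0.
Proof.
rewrite mxE (bigD1 j) //= big1 ?addr0 => [|i /negPf ij].
  by rewrite mxE eqxx mulr1.
by rewrite mxE (inj_eq (@axis_map_inj g)) eq_sym ij mulr0 mul0r.
Qed.

Lemma full_octahedralE : Oh = range octa_mx.
Proof.
apply/seteqP; split=> [A [d [s [d_sign ->]]] | A [g _ <-]].
  have [r [m rmE]] := ord3_injective_affine (@perm_inj _ s^-1%g).
  exists (mk_octa (fun j => d 0 (s^-1%g j) == -1) r m) => //.
  apply/matrixP => i j; rewrite mul_diag_mx !mxE axis_flip_mk.
  rewrite [axis_map _ j](esym (rmE j)) -(canF_eq (permK s)).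
  have [<- | _] := eqVneq (s i) j; last by rewrite !mulr0.
  rewrite permK.
  by case: (d_sign i) => ->; rewrite ?eqxx // -subr_eq0 opprK (pnatr_eq0 _ 2).
exists (\row_i (-1) ^+ axis_flip g (axis_map g^-1%g i)).
exists (perm (@axis_map_inj g^-1%g)); split=> [i|].
  by rewrite mxE; case: axis_flip; [right | left].
apply/matrixP => i j; rewrite mul_diag_mx !mxE permE.
rewrite (canF_eq (axis_mapVK g)).
by have [->|] := eqVneq; rewrite ?axis_mapK // !mulr0.
Qed.

Lemma octa_mx_full g : Oh (octa_mx g).
Proof. by rewrite full_octahedralE; exists g. Qed.

Lemma full_octahedral_octa (A : 'M[R]_3) : Oh A -> exists g, octa_mx g = A.
Proof. by rewrite full_octahedralE => -[g _ <-]; exists g. Qed.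

(** The reference face is the triangle with vertices (1, 0, 0), (2/3, 2/3, 2/3) and
    (2/3, 2/3, -2/3), in the plane x + y / 2 = 1. *)
Definition face_normal : 'rV[R]_3 :=
  \row_j (if j == 0 then 1 else if j == 1 then 2^-1 else 0).
Definition apex : 'cV[R]_3 := delta_mx 0 0.
Definition corner : 'cV[R]_3 := (2%:R / 3%:R) *: const_mx 1.
Definition mirror_corner : 'cV[R]_3 := octa_mx face_reflection *m corner.
Definition base_face : set 'cV[R]_3 :=
  P `&` [set x | (face_normal *m x) 0 0 = 1].

Lemma face_normalE j :
  face_normal 0 j = if j == 0 then 1 else if j == 1 then 2^-1 else 0.
Proof. by rewrite mxE. Qed.

Lemma sum3 (F : 'I_3 -> R) : \sum_i F i = F 0 + F 1 + F 2%:R.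
Proof.
rewrite !big_ord_recl big_ord0 addr0 addrA.
by congr (_ + F _ + F _); apply/val_inj.
Qed.

Lemma mul_row_col3 c x :
  (c *m x) 0 0 = c 0 0 * x 0 0 + c 0 1 * x 1 0 + c 0 2%:R * x 2%:R 0.
Proof. by rewrite mxE sum3. Qed.

Lemma corner_coord j : corner j 0 = 2%:R / 3%:R.
Proof. by rewrite !mxE mulr1. Qed.

Lemma mirror_corner_coord j :
  mirror_corner j 0 = (-1) ^+ (j == 2%:R) * (2%:R / 3%:R).
Proof.
have := octa_mx_act face_reflection corner j.
rewrite axis_map_reflection corner_coord => ->; congr (_ * _).
by have [-> | -> | ->] := ord3_cases j.
Qed.

Lemma apex_coord j : apex j 0 = (j == 0)%:R.
Proof. by rewrite mxE andbT. Qed.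

Lemma apex_in_hull g : P (octa_mx g *m apex).
Proof.
apply: sub_gen_smallest; left; exists (octa_mx g) => //.
exact: octa_mx_full.
Qed.

Lemma corner_in_hull g : P (octa_mx g *m corner).
Proof.
apply: sub_gen_smallest; right; exists (octa_mx g) => //.
exact: octa_mx_full.
Qed.

(** The vertex set is invariant and the preimage of a convex set is convex. *)
Lemma octa_mx_hull g x : P x -> P (octa_mx g *m x).
Proof.
move=> Px C [Cconv CV].
apply: (Px [set y | C (octa_mx g *m y)]); split=> [y z l|y].
  rewrite !inE /= => Cy Cz.
  have := Cconv (octa_mx g *m y) (octa_mx g *m z) l.
  rewrite !inE => /(_ Cy Cz).
  by rewrite /conv /= mulmxDr -!scalemxAr.
by rewrite full_octahedralE => -[] [_ [h _ <-]] <- /=; apply: CV;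
  rewrite mulmxA -octa_mxM; [left | right]; exists (octa_mx (h * g)%g) => //;
  exact: octa_mx_full.
Qed.

(** It is enough to look at the vertices, signed permutations of (1, 0, 0) and of
    2/3 (1, 1, 1); there the value is at most the largest entry of the normal
    vector, respectively 2/3 of the sum of its entries, and both are 1. *)
Lemma face_normal_le1 x : P x -> (face_normal *m x) 0 0 <= 1.
Proof.
move=> Px.
apply: (Px [set y | (face_normal *m y) 0 0 <= 1]); split=> [y z l|y].
  rewrite !inE /= => Cy Cz.
  rewrite /conv /= mulmxDr -!scalemxAr mxE [X in X + _]mxE [X in _ + X]mxE.
  have : 0 <= l%:inum by [].
  have : l%:inum <= 1 by [].
  by rewrite /unstable.onem; nra.
have normal_ge0 j : 0 <= face_normal 0 j.
  by rewrite mxE; case: ifP => // _; case: ifP => // _; rewrite invr_ge0.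
have sign_le (b : bool) (t : R) : 0 <= t -> (-1) ^+ b * t <= t.
  by case: b => t0; rewrite ?mul1r // expr1 mulN1r; lra.
rewrite full_octahedralE => -[] [_ [g _ <-]] <- /=;
  rewrite mulmxA mul_row_col3 !mul_row_octa.
  rewrite !mxE /= !mulr0 mulr1 !addr0.
  by case: (axis_flip g 0); do 2?case: ifP => _; lra.
have : \sum_j face_normal 0 (axis_map g j) = \sum_j face_normal 0 j.
  by rewrite [RHS](reindex_inj (@axis_map_inj g)).
have := sign_le (axis_flip g 0) _ (normal_ge0 (axis_map g 0)).
have := sign_le (axis_flip g 1) _ (normal_ge0 (axis_map g 1)).
have := sign_le (axis_flip g 2%:R) _ (normal_ge0 (axis_map g 2%:R)).
rewrite !sum3 !(mxE _ _ (_ : 'I_1) _) /= => le0 le1 le2 sum_normal.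
by rewrite !corner_coord; lra.
Qed.

Lemma normal_octa_le1 g x : P x -> (face_normal *m (octa_mx g *m x)) 0 0 <= 1.
Proof. by move=> Px; apply: face_normal_le1; apply: octa_mx_hull. Qed.

(** Make the coordinates nonnegative by sign changes, then sort them. *)
Lemma exists_sorting_octa x : exists g,
  [/\ (octa_mx g *m x) 1 0 <= (octa_mx g *m x) 0 0,
      (octa_mx g *m x) 2%:R 0 <= (octa_mx g *m x) 1 0 &
      0 <= (octa_mx g *m x) 2%:R 0].
Proof.
pose a j := `|x j 0|.
pose g r m := mk_octa (fun j => x j 0 < 0) r m.
have actE r m j : (octa_mx (g r m) *m x) (axis_map (g r m) j) 0 = a j.
  by rewrite octa_mx_act axis_flip_mk -normrEsign ?num_real.
have sorted r m j0 j1 j2 : axis_map (g r m) j0 = 0 -> axis_map (g r m) j1 = 1 ->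
    axis_map (g r m) j2 = 2%:R -> a j1 <= a j0 -> a j2 <= a j1 ->
  exists g, [/\ (octa_mx g *m x) 1 0 <= (octa_mx g *m x) 0 0,
                (octa_mx g *m x) 2%:R 0 <= (octa_mx g *m x) 1 0 &
                0 <= (octa_mx g *m x) 2%:R 0].
  move=> map0 map1 map2 le10 le21; exists (g r m).
  have := (actE r m j0, actE r m j1, actE r m j2).
  by rewrite map0 map1 map2 => -[[-> ->] ->]; split; rewrite ?normr_ge0.
have [le01|/ltW le10] := lerP (a 0) (a 1);
  have [le12|/ltW le21] := lerP (a 1) (a 2%:R).
- by apply: (sorted 2%:R true 2%:R 1 0) => //; apply/val_inj.
- have [le02|/ltW le20] := lerP (a 0) (a 2%:R).
    by apply: (sorted 2%:R false 1 2%:R 0) => //; apply/val_inj.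
  by apply: (sorted 1 true 1 0 2%:R) => //; apply/val_inj.
- have [le02|/ltW le20] := lerP (a 0) (a 2%:R).
    by apply: (sorted 1 false 2%:R 0 1) => //; apply/val_inj.
  by apply: (sorted 0 true 0 2%:R 1) => //; apply/val_inj.
- by apply: (sorted 0 false 0 1 2%:R) => //; apply/val_inj.
Qed.

(** The coordinates of a point in the basis formed by the vertices of the reference
    face; they are nonnegative if x >= y >= z >= 0. *)
Lemma base_cone_coordinates x :
  x = (x 0 0 - x 1 0) *: apex + (3%:R / 4%:R * (x 1 0 + x 2%:R 0)) *: corner
      + (3%:R / 4%:R * (x 1 0 - x 2%:R 0)) *: mirror_corner.
Proof.
apply/colP => i.
move: mirror_corner mirror_corner_coord => v vE.
by have [-> | -> | ->] := ord3_cases i; rewrite !mxE vE /=; field.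
Qed.

Lemma eq_mx11 (M N : 'M[R]_1) : M 0 0 = N 0 0 -> M = N.
Proof. by move=> MN; apply/matrixP => i j; rewrite !ord1. Qed.

Lemma row_evalD c x y : (c *m (x + y)) 0 0 = (c *m x) 0 0 + (c *m y) 0 0.
Proof. by rewrite mulmxDr mxE. Qed.

Lemma row_evalZ c k x : (c *m (k *: x)) 0 0 = k * (c *m x) 0 0.
Proof. by rewrite -scalemxAr mxE. Qed.

Lemma face_normal_eval x : (face_normal *m x) 0 0 = x 0 0 + x 1 0 / 2%:R.
Proof. by rewrite mul_row_col3 !face_normalE /= mul1r mul0r addr0 mulrC. Qed.

Lemma row_eval_comb c (k1 k2 k3 : R) x y z :
  (c *m (k1 *: x + k2 *: y + k3 *: z)) 0 0 =
  k1 * (c *m x) 0 0 + k2 * (c *m y) 0 0 + k3 * (c *m z) 0 0.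
Proof. by rewrite !(row_evalD, row_evalZ). Qed.

Lemma mul_row_apex c : (c *m apex) 0 0 = c 0 0.
Proof. by rewrite mul_row_col3 !mxE /= !mulr0 mulr1 !addr0. Qed.

(** Each signed basis vector is a vertex, and one of them has positive height. *)
Lemma support_value_gt0 c b : c != 0 ->
  (forall x, P x -> (c *m x) 0 0 <= b) -> 0 < b.
Proof.
case/rV0Pn => i ci0 c_le.
pose g := mk_octa (fun=> c 0 i < 0) i false.
apply: lt_le_trans (c_le _ (apex_in_hull g)).
rewrite mulmxA mul_row_apex mul_row_octa axis_flip_mk /axis_map /= addr0.
by rewrite -normrEsign ?num_real // normr_gt0.
Qed.

(** Write [p] as a nonnegative combination of the vertices of a face.  Each vertex
    has height at most [b], so [b] is at most [b] times the sum of the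
    coefficients; this sum is the value at [p] of the normal form of the face. *)
Lemma support_meets_face c b p : 0 < b ->
    (forall x, P x -> (c *m x) 0 0 <= b) -> (c *m p) 0 0 = b ->
  exists g, 1 <= (face_normal *m (octa_mx g *m p)) 0 0.
Proof.
move=> b_gt0 c_le cp; have [g [le10 le21 ge0]] := exists_sorting_octa p.
exists g; move: le10 le21 ge0; set q := octa_mx g *m p => le10 le21 ge0.
have qE : octa_mx g^-1%g *m q = p by exact: octa_mxK.
have := c_le _ (apex_in_hull g^-1%g).
have := c_le _ (corner_in_hull g^-1%g).
have := c_le _ (octa_mx_hull g^-1%g (corner_in_hull face_reflection)).
rewrite -/mirror_corner => le2 le1 le0.
have cpE : b = (q 0 0 - q 1 0) * (c *m (octa_mx g^-1%g *m apex)) 0 0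
    + 3%:R / 4%:R * (q 1 0 + q 2%:R 0) * (c *m (octa_mx g^-1%g *m corner)) 0 0
    + 3%:R / 4%:R * (q 1 0 - q 2%:R 0)
      * (c *m (octa_mx g^-1%g *m mirror_corner)) 0 0.
  by rewrite -cp -qE mulmxA {1}(base_cone_coordinates q) row_eval_comb !mulmxA.
rewrite face_normal_eval -(ler_pM2r b_gt0) mul1r {1}cpE.
have ge01 : 0 <= q 0 0 - q 1 0 by lra.
have ge12 : 0 <= q 1 0 + q 2%:R 0 by lra.
have ge12' : 0 <= q 1 0 - q 2%:R 0 by lra.
have := ler_wpM2l ge01 le0; have := ler_wpM2l ge12 le1.
by have := ler_wpM2l ge12' le2; lra.
Qed.

Lemma image_base_face g :
  mulmx (octa_mx g^-1%g) @` base_face =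
  P `&` [set x | (face_normal *m (octa_mx g *m x)) 0 0 = 1].
Proof.
apply/seteqP; split=> [_ [x [Px xn] <-] | x [Px xn]].
  by split; [exact: octa_mx_hull | rewrite /= octa_mxVK].
exists (octa_mx g *m x); last exact: octa_mxK.
by split => //; apply: octa_mx_hull.
Qed.

(** The forms vanishing on two independent vectors of the space form a line. *)
Lemma parallel_normals (c n : 'rV[R]_3) (u v : 'cV[R]_3) : n != 0 ->
    \rank (row_mx u v) = 2%N ->
    c *m u = 0 -> c *m v = 0 -> n *m u = 0 -> n *m v = 0 ->
  exists k, c = k *: n.
Proof.
move=> n0 rk cu cv nu nv; apply/sub_rVP.
have ker_sub w : w *m u = 0 -> w *m v = 0 -> (w <= kermx (row_mx u v))%MS.
  by move=> wu wv; apply/sub_kermxP; rewrite mul_mx_row wu wv row_mx0.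
apply: submx_trans (ker_sub _ _ cu cv) _.
have := mxrank_leqif_sup (ker_sub _ _ nu nv).
by move=> [_ <-]; rewrite mxrank_ker rk rank_rV n0.
Qed.

(** [support_meets_face] is applied to the centroid of three independent points of
    [F]: on the polyhedron the normal form of the face is at most 1, so a mean
    value of 1 forces the value 1 at each of the three points. *)
Lemma facet_classification F : facets P F ->
  exists g, F = mulmx (octa_mx g) @` base_face.
Proof.
case=> c [b [c0 c_le FE [x [y [z [Fx Fy Fz rk]]]]]].
have b_gt0 := support_value_gt0 c0 c_le.
pose p := 3%:R^-1 *: (x + y + z).
have F_P w : F w -> P w by rewrite FE => -[].
have F_c w : F w -> (c *m w) 0 0 = b by rewrite FE => -[].
have [|g g_ge1] := support_meets_face b_gt0 c_le (p := p).
  by rewrite row_evalZ !row_evalD !F_c //; field.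
pose n := face_normal *m octa_mx g.
have n_le w : P w -> (n *m w) 0 0 <= 1.
  by rewrite /n -mulmxA; exact: normal_octa_le1.
have [nx ny nz] : [/\ (n *m x) 0 0 = 1, (n *m y) 0 0 = 1 & (n *m z) 0 0 = 1].
  move: g_ge1; rewrite mulmxA -/n row_evalZ !row_evalD.
  by have := (n_le x (F_P x Fx), n_le y (F_P y Fy), n_le z (F_P z Fz));
    move=> [[? ?] ?] ?; split; lra.
have n_neq0 : n != 0.
  apply/eqP => n0; move: nx; rewrite n0 mul0mx mxE => /esym/eqP.
  by rewrite oner_eq0.
have diff0 (w : 'rV[R]_3) (s t : 'cV[R]_3) :
    (w *m s) 0 0 = (w *m t) 0 0 -> w *m (s - t) = 0.
  by move=> st; rewrite mulmxBr (eq_mx11 st) subrr.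
have [||||k ck] := parallel_normals n_neq0 rk (c := c);
  try by apply: diff0; rewrite ?F_c // ?nx ?ny ?nz.
have kb : k = b by rewrite -(F_c x Fx) ck -scalemxAl mxE nx mulr1.
exists g^-1%g; rewrite image_base_face FE; congr (_ `&` _).
have cw w : (c *m w) 0 0 = b * (n *m w) 0 0.
  by rewrite ck kb -scalemxAl mxE.
apply/seteqP; split => w /=; rewrite mulmxA -/n cw.
  by rewrite -[RHS]mulr1 => /(mulfI (lt0r_neq0 b_gt0)).
by move=> ->; exact: mulr1.
Qed.

Lemma octa_facet g F : facets P F -> facets P (mulmx (octa_mx g) @` F).
Proof.
case=> c [b [c0 c_le FE [x [y [z [Fx Fy Fz rk]]]]]].
exists (c *m octa_mx g^-1%g), b; split.
- apply: contra_neq c0 => cg.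
  have := congr1 (mulmxr (octa_mx g)) cg.
  by rewrite /= mul0mx -mulmxA -octa_mxM mulgV octa_mx1 mulmx1.
- by move=> w Pw; rewrite -mulmxA; apply: c_le; exact: octa_mx_hull.
- apply/seteqP; split=> [_ [w Fw <-] | w [Pw wb]].
    move: Fw; rewrite FE => -[Pw wb]; split; first exact: octa_mx_hull.
    by rewrite /= -mulmxA octa_mxK.
  exists (octa_mx g^-1%g *m w); last exact: octa_mxVK.
  by rewrite FE; split; [exact: octa_mx_hull | rewrite /= mulmxA].
exists (octa_mx g *m x), (octa_mx g *m y), (octa_mx g *m z).
split; [by exists x | by exists y | by exists z |].
have full : row_full (octa_mx g).
  apply/row_fullP; exists (octa_mx g^-1%g).
  by rewrite -octa_mxM mulgV octa_mx1.
by rewrite -!mulmxBr -mul_mx_row (eqmxMfull _ full).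
Qed.

Lemma apex_base_face : base_face apex.
Proof.
split; first by rewrite -[apex]mul1mx -octa_mx1; exact: apex_in_hull.
by rewrite /= face_normal_eval !apex_coord /= mul0r addr0.
Qed.

Lemma corner_base_face : base_face corner.
Proof.
split; first by rewrite -[corner]mul1mx -octa_mx1; exact: corner_in_hull.
by rewrite /= face_normal_eval !corner_coord; field.
Qed.

Lemma mirror_corner_base_face : base_face mirror_corner.
Proof.
split; first exact: corner_in_hull.
by rewrite /= face_normal_eval !mirror_corner_coord /=; field.
Qed.

(** The rank condition is proved by exhibiting a left inverse of the edge matrix. *)
Lemma base_face_facet : facets P base_face.
Proof.
exists face_normal, 1; split => //.
- by apply/eqP => /matrixP /(_ 0 0); rewrite !mxE /= => /eqP; rewrite oner_eq0.
- exact: face_normal_le1.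
exists apex, corner, mirror_corner; split.
- exact: apex_base_face.
- exact: corner_base_face.
- exact: mirror_corner_base_face.
apply/eqP; rewrite -[_ == _]/(row_full _); apply/row_fullP.
pose e1 : 'rV[R]_3 := \row_j (if j == 0 then 0 else 3%:R / 4%:R).
pose e2 : 'rV[R]_3 :=
  \row_j (if j == 0 then 0 else
          if j == 1 then 3%:R / 4%:R else - (3%:R / 4%:R)).
exists (col_mx e1 e2); rewrite mul_col_row.
have d1 j : (corner - apex) j 0 = 2%:R / 3%:R - (j == 0)%:R.
  by rewrite mxE [X in _ + X]mxE corner_coord apex_coord.
have d2 j : (mirror_corner - apex) j 0 =
    (-1) ^+ (j == 2%:R) * (2%:R / 3%:R) - (j == 0)%:R.
  by rewrite mxE [X in _ + X]mxE mirror_corner_coord apex_coord.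
have e1E j : e1 0 j = if j == 0 then 0 else 3%:R / 4%:R by rewrite mxE.
have e2E j : e2 0 j =
    if j == 0 then 0 else if j == 1 then 3%:R / 4%:R else - (3%:R / 4%:R).
  by rewrite mxE.
rewrite [RHS](@scalar_mx_block _ 1 1); congr block_mx; apply: eq_mx11;
  rewrite mul_row_col3 ?d1 ?d2 ?e1E ?e2E mxE /=; by field.
Qed.

Lemma face_reflection_base_face :
  mulmx (octa_mx face_reflection) @` base_face = base_face.
Proof.
have normalE x :
    face_normal *m (octa_mx face_reflection *m x) = face_normal *m x.
  rewrite mulmxA; congr (_ *m _); apply/rowP => j.
  rewrite mul_row_octa.
  rewrite axis_map_reflection.
  rewrite face_normalE.
  by have [-> | -> | ->] := ord3_cases j; rewrite /= ?mul1r ?mulr0.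
have reflK x : octa_mx face_reflection *m (octa_mx face_reflection *m x) = x.
  rewrite mulmxA -octa_mxM (_ : _ * _ = 1)%g ?octa_mx1 ?mul1mx //.
  by apply/eqP; vm_compute.
apply/seteqP; split=> [_ [x [Px xn] <-] | x [Px xn]].
  by split; [exact: octa_mx_hull | rewrite /= normalE].
exists (octa_mx face_reflection *m x) => //.
by split; [exact: octa_mx_hull | rewrite /= normalE].
Qed.

(** The vertices of the face span the space, so an element of the stabilizer fixes
    the normal form x + y / 2; its first two coefficients determine the images of
    the first two axes. *)
Lemma base_face_stab g :
    mulmx (octa_mx g) @` base_face = base_face ->
  g = 1%g \/ g = face_reflection.
Proof.
move=> gF.
have on_plane x : base_face x -> (face_normal *m octa_mx g *m x) 0 0 = 1.
  move=> Fx; have [] : base_face (octa_mx g *m x) by rewrite -gF; exists x.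
  by rewrite -mulmxA.
have := on_plane _ apex_base_face; rewrite mul_row_apex => n0.
have := on_plane _ corner_base_face; have := on_plane _ mirror_corner_base_face.
rewrite !mul_row_col3 !corner_coord !mirror_corner_coord /= n0 => e1 e2.
have {e1 e2} n1 : (face_normal *m octa_mx g) 0 1 = 2^-1 by lra.
move: n0 n1; rewrite !mul_row_octa !face_normalE.
case: g {gF on_plane} => [[[s0 s1] s2] [r m]].
rewrite [axis_flip _ 0]/axis_flip [axis_flip _ 1]/axis_flip /axis_map /=.
rewrite addr0 subr0 if_same.
have [-> | -> | ->] := ord3_cases r; case: m; case: s0; case: s1 => /= n0 n1;
  try (exfalso; lra).
by case: s2; [right | left].
Qed.

End Geometry.

(** * Tilings as sections *)
Section Faces.
Variable R : realType.
Local Notation Oh := (full_octahedral R).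
Local Notation octa_mx := (@octa_mx R).
Local Notation P := (tetrakis_hexahedron R).

(** An alias of the type of facets, which carries the finite type structure
    transported from the group along the transitive action. *)
Definition face : Type := facets P.

Definition move_face (g : octa) (F : face) : face :=
  exist _ (mulmx (octa_mx g) @` val F) (mem_set (octa_facet g (set_valP F))).

Definition base : face := exist _ (@base_face R) (mem_set (base_face_facet R)).

Lemma face_ex (F : face) : exists g, F = move_face g base.
Proof.
by have [g FE] := facet_classification (set_valP F); exists g; apply/val_inj.
Qed.

Definition face_code (F : face) : octa := projT1 (cid (face_ex F)).

Lemma face_codeK : cancel face_code (move_face^~ base).
Proof. by move=> F; rewrite /face_code; case: cid. Qed.

HB.instance Definition _ := Finite.copy face (can_type face_codeK).

Lemma move_face1 : move_face 1%g =1 id.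
Proof.
move=> F; apply/val_inj => /=; rewrite octa_mx1.
by rewrite -[RHS]image_id; apply: eq_imagel => x _ /=; rewrite mul1mx.
Qed.

Lemma move_faceM (F : face) g h :
  move_face (g * h)%g F = move_face h (move_face g F).
Proof.
apply/val_inj => /=; rewrite octa_mxM image_comp.
by apply: eq_imagel => x _ /=; rewrite mulmxA.
Qed.

Definition face_action :=
  @TotalAction octa face (fun F g => move_face g F) move_face1 move_faceM.

Lemma move_base_transitive (F : face) : exists g, F = face_action base g.
Proof. exact: face_ex. Qed.

Lemma base_stabilizer :
  'C[base | face_action]%g = [set 1%g; face_reflection]%SET.
Proof.
apply/setP => g; apply/astab1P/set2P => [/(congr1 val) | [] ->].
- exact: base_face_stab.
- exact: act1.
- by apply/val_inj; exact: face_reflection_base_face.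
Qed.

Variable TD : tile_designs P Oh.

Definition design_act (p : tile TD * face) (g : octa) : tile TD * face :=
  @Defs.act _ _ _ TD (octa_mx g) p.

Lemma design_act1 : design_act^~ 1%g =1 id.
Proof. by move=> p; rewrite /design_act octa_mx1 Defs.act1. Qed.

Lemma design_actM p : act_morph design_act p.
Proof.
by move=> g h; rewrite /design_act octa_mxM Defs.actM //; exact: octa_mx_full.
Qed.

Definition design_action := TotalAction design_act1 design_actM.

Lemma design_action_over p g : (design_action p g).2 = face_action p.2 g.
Proof.
case: p => t F; apply/val_inj.
by rewrite /= /design_act act_over //; exact: octa_mx_full.
Qed.

Local Notation sact := (section_action design_action_over).

Lemma moves_toE (tau tau' : tiling TD) g :
  moves_to (octa_mx g) tau tau' <->
  sact (finfun (tau : face -> _)) g = finfun (tau' : face -> _).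
Proof.
rewrite -(section_actP design_action_over); split=> [tauE F | tauE].
  have : tiling_graph tau' (design_action (tau F, F) g).
    by rewrite -tauE; exists (tau F, F) => //; exists F.
  rewrite !ffunE => -[F' _] eqF'; rewrite -eqF'.
  have := design_action_over (tau F, F) g; rewrite -eqF' /= => ->.
  by [].
apply/seteqP; split=> [_ [_ [F _ <-] <-] | _ [F _ <-]].
  have := tauE F; rewrite !ffunE /= /design_act => ->.
  by exists (move_face g F).
pose F' := move_face g^-1%g F; exists (tau F', F'); first by exists F'.
by have := tauE F'; rewrite !ffunE /= -move_faceM mulVg move_face1.
Qed.

Let orbs := (orbit sact [set: octa] @: [set: {ffun face -> tile TD}])%SET.

(** A tiling is a function, while the finite action is on finite functions; this
    translates sets of the latter into sets of the former. *)
Definition as_tilings (O : {set {ffun face -> tile TD}}) : set (tiling TD) :=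
  [set tau | finfun (tau : face -> _) \in O].

Lemma as_tilings_inj : injective as_tilings.
Proof.
move=> O O' eqO; apply/setP => s.
have := congr1 (fun A : set (tiling TD) => A (s : face -> _)) eqO.
by rewrite /as_tilings /= ffunK => /is_true_inj.
Qed.

Lemma tiling_orbitE (tau : tiling TD) :
  tiling_orbit tau =
  as_tilings (orbit sact [set: octa]%SET (finfun (tau : face -> _))).
Proof.
apply/seteqP; split=> tau'; rewrite /as_tilings /=.
  move=> [A]; rewrite {1}full_octahedralE => -[g _ <-] /moves_toE <-.
  by apply: imset_f; rewrite inE.
case/orbitP => g _ /moves_toE gtau; exists (octa_mx g) => //.
exact: octa_mx_full.
Qed.

Lemma tiling_orbitsE : tiling_orbits TD = as_tilings @` [set` orbs].
Proof.
apply/seteqP; split=> [_ [tau _ <-] | _ [_ /imsetP[s _ ->] <-]].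
  rewrite tiling_orbitE.
  by exists (orbit sact [set: octa]%SET (finfun (tau : face -> _)));
    first exact: imset_f.
by exists (s : face -> _) => //; rewrite tiling_orbitE ffunK.
Qed.

Lemma finite_tiling_orbits : finite_set (tiling_orbits TD).
Proof.
by rewrite tiling_orbitsE; apply: finite_image; exact: finite_finset.
Qed.

Lemma number_of_tilingsE : number_of_tilings TD = #|orbs|.
Proof.
rewrite /number_of_tilings tiling_orbitsE.
have fin : finite_set (as_tilings @` [set` orbs]).
  by rewrite -tiling_orbitsE; exact: finite_tiling_orbits.
have -> : fset_set (as_tilings @` [set` orbs]) =
          [fset as_tilings O | O in orbs]%fset.
  apply/fsetP => A; rewrite in_fset_set //.
  apply/idP/imfsetP => [/set_mem[O OS <-] | [O OS ->]]; first by exists O.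
  by apply/mem_set; exists O.
by rewrite card_imfset //= ?cardE //; exact: as_tilings_inj.
Qed.

(** An isometry of the group that induces a nontrivial map on [F] is the nontrivial
    element of the stabilizer of [F], so there is only one. *)
Lemma fixed_tilesE (F : facets P) (f : val F -> val F) (a : octa) :
    induces Oh (octa_mx a) f -> (exists x, f x <> x) ->
  a != 1%g /\
  fixed_tiles TD f =
    #|[set t | design_action (t, F : face) a == (t, F : face)]%SET|.
Proof.
move=> a_ind [x fx].
have stabE g :
    induces Oh (octa_mx g) f -> g != 1%g /\ face_action (F : face) g = F.
  move=> [[_ gF] g_f]; split; last exact/val_inj.
  by apply/eqP => g1; apply/fx/val_inj; rewrite g_f g1 octa_mx1 mul1mx.
have [a1 aF] := stabE _ a_ind; split=> //.
apply: eq_card => t; rewrite !inE; apply/asboolP/eqP => [[A A_ind] | actF].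
  have [g gA] : exists g, octa_mx g = A.
    by apply/full_octahedral_octa; have [[]] := A_ind.
  move: A_ind; rewrite -gA => g_ind.
  have [g1 gF] := stabE _ g_ind.
  by rewrite (face_stabilizer_unique move_base_transitive base_stabilizer
                aF gF a1 g1).
by exists (octa_mx a).
Qed.

Lemma number_of_tilings_formula (F : facets P) (f : val F -> val F) :
    induced_symmetry_group Oh F f -> (exists x, f x <> x) ->
  let t := #|tile TD| in let n := fixed_tiles TD f in
  (number_of_tilings TD * 48 =
   t ^ 24 + 16 * t ^ 12 + 8 * t ^ 8 + 12 * t ^ 6 + 8 * t ^ 4
   + 3 * t ^ 8 * n ^ 8)%N.
Proof.
move=> [A A_ind] fx t n.
have [a aA] : exists a, octa_mx a = A.
  by apply/full_octahedral_octa; have [[]] := A_ind.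
move: A_ind; rewrite -aA => a_ind.
have [a1 nE] := fixed_tilesE a_ind fx.
have aF : face_action (F : face) a = F.
  by case: a_ind => -[_ aF] _; exact/val_inj.
rewrite /n nE (card_fixed_tiles_transport design_action_over
  move_base_transitive base_stabilizer aF a1).
rewrite number_of_tilingsE.
exact: (card_section_orbits design_action_over move_base_transitive
         base_stabilizer).
Qed.

End Faces.

Theorem theorem8 (R : realType)
    (TD : tile_designs (tetrakis_hexahedron R) (full_octahedral R))
    (F : facets (tetrakis_hexahedron R)) (f : val F -> val F)
    (f_sym : induced_symmetry_group (full_octahedral R) F f)
    (f_refl : isosceles_reflection f)
    (t_id t_f : nat)
    (t_idE : t_id = #|tile TD|)
    (t_fE : t_f = fixed_tiles TD f) :
  finite_set (tiling_orbits TD) /\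
  (number_of_tilings TD)%:R =
    1 / 48%:R *
      (t_id ^ 24 + 6 * t_id ^ 6 + 3 * t_id ^ 12 + 8 * t_id ^ 8
       + 6 * t_id ^ 12 + t_id ^ 12 + 6 * t_id ^ 6
       + 3 * t_id ^ 8 * t_f ^ 8 + 8 * t_id ^ 4 + 6 * t_id ^ 12)%N%:R
    :> rat /\
  1 / 48%:R *
      (t_id ^ 24 + 6 * t_id ^ 6 + 3 * t_id ^ 12 + 8 * t_id ^ 8
       + 6 * t_id ^ 12 + t_id ^ 12 + 6 * t_id ^ 6
       + 3 * t_id ^ 8 * t_f ^ 8 + 8 * t_id ^ 4 + 6 * t_id ^ 12)%N%:R
    = 1 / 48%:R *
      (t_id ^ 24 + 16 * t_id ^ 12 + 8 * t_id ^ 8 + 12 * t_id ^ 6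
       + 8 * t_id ^ 4 + 3 * t_id ^ 8 * t_f ^ 8)%N%:R
    :> rat.
Proof.
(* The reflection exchanges the two base vertices, so it is not the identity. *)
have fx : exists x, f x <> x.
  by case: f_refl => a [b [c [_ bc _ [_ fb _]]]]; exists b; rewrite fb => /esym.
have := number_of_tilings_formula TD f_sym fx.
rewrite -t_idE -t_fE => count; split; first exact: finite_tiling_orbits.
suff -> : (t_id ^ 24 + 6 * t_id ^ 6 + 3 * t_id ^ 12 + 8 * t_id ^ 8
       + 6 * t_id ^ 12 + t_id ^ 12 + 6 * t_id ^ 6
       + 3 * t_id ^ 8 * t_f ^ 8 + 8 * t_id ^ 4 + 6 * t_id ^ 12 =
     t_id ^ 24 + 16 * t_id ^ 12 + 8 * t_id ^ 8 + 12 * t_id ^ 6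
       + 8 * t_id ^ 4 + 3 * t_id ^ 8 * t_f ^ 8)%N.
  split=> //; rewrite -count natrM div1r [RHS]mulrC mulfK //.
by ring.
Qed.
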